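(* $\mathbf{NP}_{\mathrm{IS}}=\mathrm{NP/poly}$, where each Boolean function family $(f_n)_{n\in\mathbb N}$ is identified with the unique function $f:\mathbb B^*\to\mathbb B$ such that $f(w)=f_n(w)$ for each $n$ and $w\in\mathbb B^n$.
   Context: Let $\mathbb B=\{\mathsf T,\mathsf F\}$. There are Boolean registers named $\mathtt{in}{:}i$, $\mathtt{aux}{:}i$ ($i\ge1$) and $\mathtt{out}$, processing methods $\mathtt{set{:}T}$ (content becomes $\mathsf T$, reply $\mathsf T$), $\mathtt{set{:}F}$ (content becomes $\mathsf F$, reply $\mathsf F$), $\mathtt{get}$ (no change, reply is the content). Basic instructions are $f.m$. Primitive instructions: for each basic instruction $a$, the plain instruction $a$, positive test $+a$, negative test $-a$; forward jumps $\#l$ ($l\in\mathbb N$); termination $!$. An instruction sequence is a finite non-empty sequence $X=u_1;\dots;u_k$ of primitive instructions, $|X|=k$. Execution starts at $u_1$: $a$ executes $a$ and proceeds with the next instruction; $+a$ executes $a$ and proceeds with the next instruction if the reply is $\mathsf T$, otherwise skips the next instruction and proceeds with the one after; $-a$ likewise with reply roles reversed; $\#l$ proceeds with the $l$-th next instruction ($\#0$ causes inaction); $!$ terminates; if there is no instruction to proceed with, inaction occurs. $\mathcal{IS}_{br}$ is the set of instruction sequences whose basic instructions are all of the forms $\mathtt{in}{:}i.\mathtt{get}$, $\mathtt{aux}{:}i.\mathtt{get}$, $\mathtt{aux}{:}i.\mathtt{set{:}}b$, $\mathtt{out}.\mathtt{set{:}}b$. $X$ computes $f:\mathbb B^n\to\mathbb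 B$ if for all $b_1,\dots,b_n$, executing $X$ with $\mathtt{in}{:}i$ initially $b_i$ ($i\le n$) and all auxiliary registers and $\mathtt{out}$ initially $\mathsf F$, execution never executes an instruction on $\mathtt{in}{:}i$ with $i>n$, ends by executing $!$, and leaves $f(b_1,\dots,b_n)$ in $\mathtt{out}$. A Boolean function family is a sequence $(f_n)_{n\in\mathbb N}$ with $f_n:\mathbb B^n\to\mathbb B$. $\mathbf P_{\mathrm{IS}}$ is the class of families $(g_n)$ for which there is a polynomial $h$ such that for every $n$ some $X\in\mathcal{IS}_{br}$ computes $g_n$ with $|X|\le h(n)$. $\mathbf{NP}_{\mathrm{IS}}$ is the class of families $(f_n)$ for which there exist a monotonic polynomial $h:\mathbb N\to\mathbb N$ and $(g_n)\in\mathbf P_{\mathrm{IS}}$ such that for all $n$ and $w\in\mathbb B^n$: $f_n(w)=\mathsf T\iff\exists c\in\mathbb B^{h(n)}\,g_{n+h(n)}(wc)=\mathsf T$ ($wc$ is concatenation). $\mathrm{NP/poly}$ is the standard non-uniform complexity class (NP with polynomial-length advice). *)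

(* Defs.v *)
From HB Require Import structures.
From mathcomp Require Import all_boot all_order all_algebra.
From mathcomp Require Import all_classical.

Set Implicit Arguments.
Unset Strict Implicit.
Unset Printing Implicit Defensive.

Import GRing.Theory.

Local Open Scope classical_set_scope.

(* Polynomial functions from nat to nat. Rational coefficients give all of
   them: n (n - 1) / 2 has no natural or integral coefficients, and a real
   polynomial mapping nat to nat has rational ones. *)
Definition poly_fun (h : nat -> nat) : Prop :=
  exists p : {poly rat}, forall n, ((h n)%:R = p.[n%:R])%R.

Inductive focus := Input of nat | Aux of nat | Out.

Inductive meth := Set_ of bool | Get.

Definition basic := (focus * meth)%type.

Inductive instr :=
  | Plain of basic
  | PosTest of basic
  | NegTest of basic
  | Jump of nat
  | Term.

(* Registers are numbered from 1, so index 0 is excluded. *)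
Definition br_basic (a : basic) : bool :=
  match a with
  | (Input i, Get) => 0 < i
  | (Aux i, _) => 0 < i
  | (Out, Set_ _) => true
  | _ => false
  end.

Definition br_instr (u : instr) : bool :=
  match u with
  | Plain a | PosTest a | NegTest a => br_basic a
  | Jump _ | Term => true
  end.

Definition IS_br : set (seq instr) :=
  [set X | (0 < size X) && all br_instr X].

(* None: there is no such register. *)
Definition registers := focus -> option bool.

Definition focus_eqb (f g : focus) : bool :=
  match f, g with
  | Input i, Input j | Aux i, Aux j => i == j
  | Out, Out => true
  | _, _ => false
  end.

Definition update (r : registers) (f : focus) (b : bool) : registers :=
  fun g => if focus_eqb f g then Some b else r g.

(* The new registers and the reply, or None if the register is absent. For each
   of the three methods, the reply is the content after its execution. *)
Definition exec_basic (a : basic) (r : registers) : option (registers * bool) :=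
  let: (f, m) := a in
  if r f is Some c then
    let c' := if m is Set_ b then b else c in Some (update r f c', c')
  else None.

(* [exec k X r] executes [X] from its instruction number [k] (counted from 0)
   on. The result is the final registers if execution ends with Term, and None
   if it ends in inaction. As jumps are forward, recursion on [X] suffices; in
   the Jump case [X'] already starts with the next instruction. *)
Fixpoint exec (k : nat) (X : seq instr) (r : registers) : option registers :=
  match X, k with
  | [::], _ => None
  | _ :: X', k'.+1 => exec k' X' r
  | u :: X', 0 =>
    match u with
    | Plain a =>
        if exec_basic a r is Some (r', _) then exec 0 X' r' else None
    | PosTest a =>
        if exec_basic a r is Some (r', b) then exec (if b then 0 else 1) X' r'
        else None
    | NegTest a =>
        if exec_basic a r is Some (r', b) then exec (if b then 1 else 0) X' r'
        else None
    | Jump 0 => None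
    | Jump l.+1 => exec l X' r
    | Term => Some r
    end
  end.

(* On input [w] only the input registers 1, ..., size w are present, so using
   another one makes execution fail to terminate properly. *)
Definition init_registers (w : seq bool) : registers := fun f =>
  match f with
  | Input i.+1 => onth w i
  | Aux _.+1 | Out => Some false
  | Input 0 | Aux 0 => None
  end.

Definition computes (X : seq instr) (n : nat) (f : n.-tuple bool -> bool) :
    Prop :=
  forall w : n.-tuple bool, exists r : registers,
    exec 0 X (init_registers w) = Some r /\ r Out = Some (f w).

Definition family := forall n : nat, n.-tuple bool -> bool.

Definition to_fun (f : family) : seq bool -> bool :=
  fun w => f (size w) (in_tuple w).

Lemma to_funE (f : family) (n : nat) (w : n.-tuple bool) : to_fun f w = f n w.
Proof.
rewrite /to_fun; case: w => s /= sn.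
move: (sn); case: _ / (eqP sn) => sn'.
by congr (f _ _); apply: val_inj.
Qed.

Definition P_IS : set family :=
  [set g | exists h : nat -> nat, poly_fun h /\
    forall n, exists X : seq instr,
      [/\ IS_br X, computes X (g n) & size X <= h n]].

Definition NP_IS : set family :=
  [set f | exists (h : nat -> nat) (g : family),
    [/\ poly_fun h, {homo h : m n / m <= n}, P_IS g &
      forall (n : nat) (w : n.-tuple bool),
        f n w = true <->
        exists c : (h n).-tuple bool, g (n + h n) (cat_tuple w c) = true]].

Inductive move := MoveLeft | Stay | MoveRight.

(* Two-way infinite tape: the cells left of the head (nearest first), the
   scanned cell, the cells right of the head; all further cells are blank. *)
Definition tape (G : Type) := (seq G * G * seq G)%type.

Definition scanned (G : Type) (t : tape G) : G := t.1.2.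

Definition write_move (G : Type) (blank : G) (a : G * move) (t : tape G) :
    tape G :=
  let: (l, _, r) := t in
  let: (x, d) := a in
  match d with
  | MoveLeft => (behead l, head blank l, x :: r)
  | Stay => (l, x, r)
  | MoveRight => (x :: l, head blank r, behead r)
  end.

Definition tape_of (G : Type) (blank : G) (s : seq G) : tape G :=
  ([::], head blank s, behead s).

(* Nondeterministic machine with [ntapes.+1] tapes and input alphabet [S].
   [delta q s q' a] holds if, in state [q] scanning the symbols [s], the machine
   may go to state [q'] performing the actions [a] on its tapes. *)
Record ntm (S : finType) := NTM {
  ntapes : nat;
  state : finType;
  symbol : finType;
  blank : symbol;
  letter : S -> symbol;
  letter_inj : injective letter;
  letter_blank : forall x : S, letter x != blank;
  start : state;
  accepting : pred state;
  delta : state -> {ffun 'I_ntapes.+1 -> symbol} ->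
          state -> {ffun 'I_ntapes.+1 -> symbol * move} -> bool
}.

Definition config (S : finType) (M : ntm S) : Type :=
  (state M * {ffun 'I_(ntapes M).+1 -> tape (symbol M)})%type.

Definition init_config (S : finType) (M : ntm S) (x : seq S) : config M :=
  (start M, [ffun i => tape_of (blank M)
                         (if i == ord0 then map (@letter S M) x else [::])]).

Definition step (S : finType) (M : ntm S) (c c' : config M) : Prop :=
  exists a : {ffun 'I_(ntapes M).+1 -> symbol M * move},
    delta c.1 [ffun i => scanned (c.2 i)] c'.1 a /\
    c'.2 = [ffun i => write_move (blank M) (a i) (c.2 i)].

Definition halted (S : finType) (M : ntm S) (c : config M) : Prop := forall c', ~ step c c'.

(* Every computation from [c] halts after at most [t] steps. *)
Fixpoint halts_within (S : finType) (M : ntm S) (t : nat) (c : config M) : Prop :=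
  if t is t'.+1 then forall c', step c c' -> halts_within t' c' else halted c.

(* Some computation from [c] halts in an accepting state. *)
Inductive accepts (S : finType) (M : ntm S) : config M -> Prop :=
  | accepts_halted c : halted c -> accepting c.1 -> accepts c
  | accepts_step c c' : step c c' -> accepts c' -> accepts c.

Definition NP (S : finType) : set (set (seq S)) :=
  [set L | exists (M : ntm S) (p : nat -> nat),
    [/\ poly_fun p,
        forall x : seq S, halts_within (p (size x)) (init_config M x) &
        forall x : seq S, L x <-> accepts (init_config M x)]].

(* The pair of two bit strings, as a string over {F, T, #} with # := None. *)
Definition pair_string (w v : seq bool) : seq (option bool) :=
  map Some w ++ None :: map Some v.

(* Languages over bool are given by their characteristic functions. *)
Definition NP_poly : set (seq bool -> bool) :=
  [set F | exists (L : set (seq (option bool))) (p : nat -> nat)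
             (advice : nat -> seq bool),
    [/\ NP L, poly_fun p, forall n, size (advice n) <= p n &
      forall w : seq bool,
        F w = true <-> L (pair_string w (advice (size w)))]].

(* Main.v *)
(* NP/poly is contained in NP_IS by the tableau method: the certificate encodes,
   one bit for each value of each cell, a computation table of the machine on
   the pair of the input and the advice. That the table is an accepting
   computation is a conjunction of polynomially many clauses over the bits of
   the input and of the certificate, and a clause is checked by tests and
   forward jumps only.

   NP_IS is contained in NP/poly because one fixed two-tape machine suffices. It
   reads its input once from left to right: it copies the input proper to its
   memory tape and then obeys the advice as a list of operations on that tape,
   one of which guesses a bit. The advice for length [n] guesses the certificate
   and then simulates the instruction sequence. As jumps are forward, a single
   pass over the instructions is enough: each has a flag in memory saying that
   control reaches it, so that all head moves can be fixed in advance. *)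
Require Import Defs.
From HB Require Import structures.
From mathcomp Require Import all_boot all_order all_algebra.
From mathcomp Require Import all_classical.
From mathcomp Require Import zify.

Set Implicit Arguments.
Unset Strict Implicit.
Unset Printing Implicit Defensive.

Import Order.TTheory GRing.Theory Num.Theory.

Local Open Scope classical_set_scope.

(** * Polynomial bounds *)

(** The base [n.+2] is at least 2 even for [n = 0], so powers of it dominate every constant. They
    are themselves monotone polynomials and can replace any other polynomial bound. *)
Definition poly_bounded (F : nat -> nat) : Prop :=
  exists k, forall n, F n <= n.+2 ^ k.

Lemma poly_bounded_le (F G : nat -> nat) :
  (forall n, F n <= G n) -> poly_bounded G -> poly_bounded F.
Proof. by move=> FG [k Gk]; exists k => n; apply: leq_trans (FG n) (Gk n). Qed.

Lemma poly_bounded_const (C : nat) : poly_bounded (fun=> C).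
Proof.
exists C => n; apply: leq_trans (ltnW (ltn_expl C (isT : 1 < 2))) _.
by case: C => [|C] //; rewrite leq_exp2r.
Qed.

Lemma poly_bounded_id : poly_bounded id.
Proof. by exists 1 => n; rewrite expn1; lia. Qed.

Lemma poly_bounded_mul (F G : nat -> nat) :
  poly_bounded F -> poly_bounded G -> poly_bounded (fun n => F n * G n).
Proof. by move=> [k Fk] [l Gl]; exists (k + l) => n; rewrite expnD leq_mul. Qed.

Lemma poly_bounded_add (F G : nat -> nat) :
  poly_bounded F -> poly_bounded G -> poly_bounded (fun n => F n + G n).
Proof.
move=> [k Fk] [l Gl]; exists (k + l).+1 => n.
rewrite expnS; apply: leq_trans (leq_add (Fk n) (Gl n)) _.
have ? : n.+2 ^ k <= n.+2 ^ (k + l) by rewrite leq_exp2l // leq_addr.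
have ? : n.+2 ^ l <= n.+2 ^ (k + l) by rewrite leq_exp2l // leq_addl.
nia.
Qed.

Lemma poly_bounded_comp (F G : nat -> nat) :
  poly_bounded F -> poly_bounded G -> poly_bounded (F \o G).
Proof.
(* With [x = n.+2 ^ l >= 1], [(G n).+2 <= x + 2 <= n.+2 ^ 2 * x], whence the exponent [l.+2]. *)
move=> [k Fk] [l Gl]; exists (l.+2 * k) => n /=.
apply: leq_trans (Fk _) _; rewrite expnM.
case: k {Fk} => [|k] //; rewrite leq_exp2r // !expnS.
have : 0 < n.+2 ^ l by rewrite expn_gt0.
move: (Gl n); move: (n.+2 ^ l) => x; nia.
Qed.

(** Induction along the Horner scheme. Absolute values are bounded, because the polynomials met on
    the way may take negative or fractional values. *)
Lemma poly_fun_bounded (h : nat -> nat) : poly_fun h -> poly_bounded h.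
Proof.
move=> [p hp].
suff [k pk] : exists k, forall n : nat, (`|p.[n%:R]| <= (n.+2 ^ k)%:R)%R.
  by exists k => n; have := pk n; rewrite -hp normr_nat ler_nat.
elim/poly_ind: p {h hp} => [|p c [k pk]].
  by exists 0 => n; rewrite horner0 normr0.
have [j cj] := poly_bounded_const (Num.bound `|c|%R).
have [i ij] : poly_bounded (fun n => n.+2 ^ k * n + Num.bound `|c|%R).
  apply: poly_bounded_add; last exact: poly_bounded_const.
  by apply: poly_bounded_mul; [exists k | exact: poly_bounded_id].
exists i => n; rewrite hornerMXaddC.
apply: le_trans (ler_normD _ _) _; rewrite normrM normr_nat.
apply: le_trans (_ : _ <= (n.+2 ^ k * n + Num.bound `|c|%R)%:R)%R _.
  rewrite natrD natrM lerD ?ler_wpM2r //.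
  exact/ltW/archi_boundP.
by rewrite ler_nat.
Qed.

Lemma poly_fun_expn (k : nat) : poly_fun (fun n => n.+2 ^ k).
Proof.
exists (('X + 2%:R%:P) ^+ k)%R => n.
by rewrite horner_exp hornerD hornerX hornerC natrX -natrD addn2.
Qed.

Lemma homo_leq_expn (k : nat) : {homo (fun n => n.+2 ^ k) : m n / m <= n}.
Proof. by move=> m n mn; case: k => [|k] //; rewrite leq_exp2r. Qed.

(** * Instruction sequences for conjunctive normal forms *)

Definition satisfies (x : seq bool) (l : nat * bool) : bool :=
  nth false x l.1 == l.2.

(** A literal that holds leads to the jump behind the clause; one that fails skips this jump and
    passes to the next literal. When all fail, [Term] is reached while [out] is still [false]. *)
Fixpoint clause_code (ls : seq (nat * bool)) : seq instr :=
  if ls is (i, b) :: ls' then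
    let c := clause_code ls' in
    (if b then PosTest else NegTest) (Input i.+1, Get) :: Jump (size c).+1 :: c
  else [:: Term].

Definition cnf_code (F : seq (seq (nat * bool))) : seq instr :=
  flatten (map clause_code F) ++ [:: Plain (Out, Set_ true); Term].

Lemma exec_cat (X Y : seq instr) (r : registers) :
  exec (size X) (X ++ Y) r = exec 0 Y r.
Proof. by elim: X. Qed.

Lemma focus_eqbP (f g : focus) : reflect (f = g) (focus_eqb f g).
Proof.
case: f g => [i|i|] [j|j|] /=; try by constructor.
- by apply: (iffP eqP) => [->|[]].
- by apply: (iffP eqP) => [->|[]].
Qed.

HB.instance Definition _ := hasDecEq.Build focus focus_eqbP.

(** Executing [Get] is modelled as an update with the present content, which thus changes
    nothing. *)
Lemma update_id (r : registers) (f : focus) (b : bool) :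
  r f = Some b -> update r f b = r.
Proof.
by move=> rf; apply/funext => g; rewrite /update; case: focus_eqbP => // <-.
Qed.

Lemma exec_clause_code (x : seq bool) (ls : seq (nat * bool)) (Y : seq instr) :
  all (fun l => l.1 < size x) ls ->
  exec 0 (clause_code ls ++ Y) (init_registers x) =
  if has (satisfies x) ls then exec 0 Y (init_registers x)
  else Some (init_registers x).
Proof.
elim: ls => [|[i b] ls IH] //= /andP[ix lsx].
have xi : init_registers x (Input i.+1) = Some (nth false x i).
  by rewrite /= (onthE) (nth_map false).
rewrite /satisfies /=.
by case: b => /=; rewrite (onthE) (nth_map false) // (update_id xi);
  case: (nth false x i) => //=; rewrite ?exec_cat ?IH.
Qed.

Lemma exec_cnf_code (x : seq bool) (F : seq (seq (nat * bool))) :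
  all (all (fun l => l.1 < size x)) F ->
  exists r, exec 0 (cnf_code F) (init_registers x) = Some r /\
    r Out = Some (all (has (satisfies x)) F).
Proof.
elim: F => [_|ls F IH /= /andP[lsx /IH [r [rE rO]]]] /=; first by eexists.
rewrite /cnf_code /= -catA exec_clause_code //.
by case: ifP => _; [exists r | eexists].
Qed.

Lemma size_clause_code (ls : seq (nat * bool)) :
  size (clause_code ls) = (size ls).*2.+1.
Proof. by elim: ls => [|[i b] ls /= ->]. Qed.

Lemma size_cnf_code (F : seq (seq (nat * bool))) (K : nat) :
  all (fun ls => size ls <= K) F -> size (cnf_code F) <= size F * K.*2.+1 + 2.
Proof.
rewrite /cnf_code size_cat /= leq_add2r.
elim: F => [|ls F IH] //= /andP[lsK /IH].
by rewrite size_cat mulSn size_clause_code; apply: leq_add; lia.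
Qed.

Lemma cnf_code_br (F : seq (seq (nat * bool))) : IS_br (cnf_code F).
Proof.
rewrite /IS_br /=; apply/andP; split; first by rewrite size_cat addnS.
rewrite all_cat andbT; elim: F => [|ls F IH] //=.
by rewrite all_cat IH andbT; elim: ls => [|[i []] ls IHls].
Qed.

(** * Local constraints on a grid of finite values, as clauses *)

Section Nogoods.

Variables (D : finType) (n T : nat).

(* A nogood forbids that its literals on the input bits hold and its grid
   points [(t, j)] carry the given values, all at the same time. *)
Definition nogood := (seq (nat * bool) * seq (nat * nat * D))%type.

Definition avoids (w : seq bool) (val : nat -> nat -> D) (g : nogood) : bool :=
  ~~ (all (satisfies w) g.1 && all (fun p => val p.1.1 p.1.2 == p.2) g.2).

Definition nogood_in_range (g : nogood) : bool :=
  all (fun l => l.1 < n) g.1 &&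
  all (fun p => (p.1.1 <= T) && (p.1.2 <= T)) g.2.

Definition nbits : nat := T.+1 * T.+1 * #|D|.

(* Bit number [bit_index p] of the input says that grid point [p.1] may carry
   the value [p.2]. *)
Definition bit_index (p : nat * nat * D) : nat :=
  n + ((p.1.1 * T.+1 + p.1.2) * #|D| + enum_rank p.2).

Definition nogood_clause (g : nogood) : seq (nat * bool) :=
  [seq (l.1, ~~ l.2) | l <- g.1] ++ [seq (bit_index p, false) | p <- g.2].

Definition value_clause (p : 'I_T.+1 * 'I_T.+1) : seq (nat * bool) :=
  [seq (bit_index (nat_of_ord p.1, nat_of_ord p.2, d), true) | d <- enum D].

Definition nogood_cnf (N : seq nogood) : seq (seq (nat * bool)) :=
  map value_clause (enum {: 'I_T.+1 * 'I_T.+1}) ++ map nogood_clause N.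

Lemma bit_index_lt (t j : nat) (d : D) :
  t <= T -> j <= T -> bit_index (t, j, d) < n + nbits.
Proof.
move=> tT jT; rewrite /bit_index /nbits ltn_add2l /=.
have := ltn_ord (enum_rank d); move: (nat_of_ord _) => i.
move: #|_| => q iq; nia.
Qed.

Lemma nogood_cnf_in_range (N : seq nogood) (m : nat) :
  n + nbits <= m -> all nogood_in_range N ->
  all (all (fun l => l.1 < m)) (nogood_cnf N).
Proof.
move=> nm /allP NT; rewrite all_cat; apply/andP; split; apply/allP => ls.
  case/mapP=> -[t j] _ ->; apply/allP => _ /mapP[d _ ->] /=.
  by apply: leq_trans (bit_index_lt _ _ _) nm; rewrite -ltnS.
case/mapP=> g /NT /andP[/allP g1 /allP g2] ->; apply/allP => l.
rewrite mem_cat => /orP[] /mapP[].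
  by move=> l' /g1 ? -> /=; apply: leq_trans nm; rewrite ltn_addr.
move=> [[t j] d] /g2 /= /andP[tT jT] -> /=.
exact: leq_trans (bit_index_lt _ tT jT) nm.
Qed.

(** No clause says that a grid point carries at most one value. This is harmless: grid bits occur
    only negatively in the clauses of nogoods, so any one of the allowed values may be chosen at
    each point. Conversely, [val] is encoded with exactly one bit set per point. *)
Lemma nogood_cnf_sat (N : seq nogood) (w : seq bool) (H : nat) :
  size w = n -> nbits <= H -> all nogood_in_range N ->
  (exists c : H.-tuple bool, all (has (satisfies (w ++ c))) (nogood_cnf N)) <->
  (exists val, all (avoids w val) N).
Proof.
move=> wn nH /allP NT; split=> [[c]|[val valN]].
  rewrite all_cat => /andP[/allP V /allP C].
  have P (p : 'I_T.+1 * 'I_T.+1) :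
      {d : D | nth false (w ++ c) (bit_index (nat_of_ord p.1, nat_of_ord p.2, d))}.
    apply: cid; have /hasP[l] := V _ (map_f value_clause (mem_enum _ p)).
    by case/mapP=> d _ -> /= /eqP; exists d.
  exists (fun t j => sval (P (inord t, inord j))); apply/allP => g gN.
  have /andP[/allP g1 /allP g2] := NT g gN.
  apply/negP => /andP[/allP h1 /allP h2].
  have /hasP[l] := C _ (map_f nogood_clause gN).
  rewrite mem_cat => /orP[] /mapP[].
    move=> l' l'g -> /=; rewrite /satisfies /= nth_cat wn (g1 _ l'g).
    by have /eqP-> := h1 _ l'g; case: l'.2.
  move=> [[t j] d] pg -> /= /eqP.
  have /= /andP[tT jT] := g2 _ pg; have /= /eqP <- := h2 _ pg.
  by case: (P _) => /= d'; rewrite !inordK // => ->.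
(* Inverts [bit_index]: the quotient by [#|D|] is the number of the grid point, counted row by row,
   and the remainder is the rank of the value. *)
pose bitv i := let q := i %/ #|D| in
  enum_rank (val (q %/ T.+1) (q %% T.+1)) == i %% #|D| :> nat.
exists (mktuple (fun i : 'I_H => bitv i)).
have bitE t j d : t <= T -> j <= T ->
    nth false (w ++ mktuple (fun i : 'I_H => bitv i)) (bit_index (t, j, d)) =
    (val t j == d).
  move=> tT jT; have := bit_index_lt d tT jT.
  rewrite /bit_index ltn_add2l /= => lt.
  rewrite nth_cat wn ltnNge leq_addr /= addKn.
  have ltH := leq_trans lt nH.
  rewrite -[X in nth _ _ X]/(nat_of_ord (Ordinal ltH)) nth_mktuple /bitv /=.
  have D0 : 0 < #|D| by apply/card_gt0P; exists d.
  rewrite divnMDl // (divn_small (ltn_ord _)) addn0.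
  rewrite divnMDl // divn_small // addn0 !modnMDl (modn_small (ltn_ord _)).
  rewrite modn_small //.
  by rewrite (inj_eq val_inj) (inj_eq enum_rank_inj).
rewrite all_cat; apply/andP; split; apply/allP => ls.
  case/mapP=> -[t j] _ ->; apply/hasP.
  exists (bit_index (nat_of_ord t, nat_of_ord j, val t j), true).
    by apply/mapP; exists (val t j); rewrite ?mem_enum.
  by rewrite /satisfies bitE ?eqxx // -ltnS.
case/mapP=> g gN ->; have /andP[/allP g1 /allP g2] := NT g gN.
have := allP valN g gN; rewrite /avoids negb_and -!has_predC.
rewrite has_cat => /orP[] /hasP[p pg /= np]; apply/orP; [left|right].
  apply/hasP; exists (p.1, ~~ p.2); first exact: map_f.
  move: np; rewrite /satisfies /= nth_cat wn (g1 _ pg).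
  by case: p.2; case: nth.
apply/hasP; exists (bit_index p, false); first by apply/mapP; exists p.
case: p pg np => [[t j] d] /g2 /= /andP[tT jT] np.
by rewrite /satisfies bitE //= (negPf np).
Qed.

Lemma size_nogood_cnf (N : seq nogood) (K : nat) :
  all (fun g => size g.1 + size g.2 <= K) N ->
  size (cnf_code (nogood_cnf N)) <=
    (T.+1 * T.+1 + size N) * (maxn K #|D|).*2.+1 + 2.
Proof.
move=> /allP NK.
have -> : T.+1 * T.+1 + size N = size (nogood_cnf N).
  by rewrite /nogood_cnf size_cat 2!size_map -cardE card_prod card_ord.
apply: size_cnf_code; rewrite all_cat; apply/andP; split; apply/allP => ls.
  by case/mapP=> p _ ->; rewrite /value_clause size_map -cardE leq_maxr.
case/mapP=> g /NK gK ->; rewrite size_cat !size_map.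
exact: leq_trans gK (leq_maxl _ _).
Qed.

End Nogoods.

(** * Computation tableaux *)

Definition move_code (d : move) : option bool :=
  match d with MoveLeft => Some true | Stay => None | MoveRight => Some false end.

Definition move_decode (o : option bool) : move :=
  match o with Some true => MoveLeft | None => Stay | Some false => MoveRight end.

Lemma move_codeK : cancel move_code move_decode. Proof. by case. Qed.

HB.instance Definition _ := Finite.copy move (can_type move_codeK).

Section Tableau.

Variables (S : finType) (M : ntm S).

Notation G := (symbol M).
Notation vec X := {ffun 'I_(ntapes M).+1 -> X}.

(* [None]: the machine has accepted, and the configuration is repeated. *)
Definition action : Type := option (state M * vec (G * move)%type).
HB.instance Definition _ := Finite.on action.

(** The action chosen is stored as well, so that the next row of the table is determined. Every cell
    has its own copy of the control, since a constraint sees only a few neighbouring cells. *)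
Definition control : Type := (state M * vec G * action)%type.
HB.instance Definition _ := Finite.on control.

(* The tapes are stored relative to their heads, so that a step acts locally:
   row [j] holds, for each tape, the [j]-th cells to the left and to the right
   of the head. *)
Definition row : Type := vec (G * G)%type.
HB.instance Definition _ := Finite.on row.

Definition cell : Type := (control * row)%type.
HB.instance Definition _ := Finite.on cell.

Definition scan (c : config M) : vec G := [ffun i => scanned (c.2 i)].

Definition row_of (c : config M) (j : nat) : row :=
  [ffun i => (nth (blank M) (c.2 i).1.1 j, nth (blank M) (c.2 i).2 j)].

Definition next_config (a : action) (c : config M) : config M :=
  if a is Some p then
    (p.1, [ffun i => write_move (blank M) (p.2 i) (c.2 i)])
  else c.

Definition control_ok (z : control) : bool :=
  if z.2 is Some p then delta z.1.1 z.1.2 p.1 p.2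
  else accepting z.1.1 && [forall q, forall a, ~~ delta z.1.1 z.1.2 q a].

Definition next_state (z : control) : state M :=
  if z.2 is Some p then p.1 else z.1.1.

Definition next_scan (z : control) (d : row) : vec G :=
  [ffun i => if z.2 is Some p then
     match (p.2 i).2 with
     | MoveLeft => (d i).1 | Stay => (p.2 i).1 | MoveRight => (d i).2
     end else z.1.2 i].

(* Row [j] of the next configuration from rows [j.-1], [j] and [j.+1] of the
   present one; [top] says that [j = 0]. *)
Definition next_row (top : bool) (z : control) (d1 d2 d3 : row) : row :=
  [ffun i => if z.2 is Some p then
     let x k := if top then (p.2 i).1 else k (d1 i) in
     match (p.2 i).2 with
     | MoveLeft => ((d3 i).1, x snd)
     | Stay => d2 i
     | MoveRight => (x fst, (d3 i).2)
     end else d2 i].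

(** [p1], [p2], [p3] stand for rows [j.-1], [j], [j.+1] at one time and [p4] for row [j] one step
    later. Comparing neighbours makes the control the same in all rows; the next control is checked
    at the top only, where the cells next to the head are at hand. *)
Definition window_ok (top : bool) (p1 p2 p3 p4 : cell) : bool :=
  [&& control_ok p2.1, p1.1 == p2.1, p3.1 == p2.1,
      p4.2 == next_row top p2.1 p1.2 p2.2 p3.2
    & top ==> (p4.1.1 == (next_state p2.1, next_scan p2.1 p2.2))].

Lemma next_scanE (c : config M) (a : action) :
  scan (next_config a c) = next_scan (c.1, scan c, a) (row_of c 0).
Proof.
apply/ffunP => i; rewrite !ffunE; case: a => [[q a]|] //=; rewrite ?ffunE //=.
by case: (c.2 i) => [[l s] r]; case: (a i) => x [] /=; rewrite ?nth0.
Qed.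

Lemma next_rowE (c : config M) (a : action) (j : nat) :
  row_of (next_config a c) j =
  next_row (j == 0) (c.1, scan c, a) (row_of c j.-1) (row_of c j) (row_of c j.+1).
Proof.
apply/ffunP => i; rewrite !ffunE; case: a => [[q a]|] //=; rewrite ?ffunE //=.
case: (c.2 i) => [[l s] r]; case: (a i) => x [] //=;
  by case: j => [|j] /=; rewrite ?nth_behead.
Qed.

Lemma stepE (c c' : config M) :
  step c c' <->
  exists p, control_ok (c.1, scan c, Some p) /\ c' = next_config (Some p) c.
Proof.
split=> [[a [ca c'E]]|[[q a] [ca ->]]].
  by exists (c'.1, a); split=> //; rewrite /next_config /= -c'E; case: (c').
by exists a.
Qed.

Lemma control_ok_None (c : config M) :
  control_ok (c.1, scan c, None) <-> accepting c.1 /\ halted c.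
Proof.
rewrite /control_ok /=; split=> [/andP[-> /forallP H]|[-> H]].
  split=> // c' /stepE[[q a] [+ _]].
  by rewrite /control_ok /= (negPf (forallP (H q) a)).
apply/forallP => q; apply/forallP => a; apply/negP => d.
by apply: (H (next_config (Some (q, a)) c)); apply/stepE; exists (q, a).
Qed.

(** A row depends on the row below it one step earlier, and the table is finite. Hence the part
    known to agree with a run shrinks to the rows with [j + t <= T]; at time [T] this still includes
    row 0, which suffices. *)
Lemma window_ok_accepts (T : nat) (val : nat -> nat -> cell) (c : config M) :
  (forall t j, t < T -> j < T -> window_ok (j == 0)
     (val t j.-1) (val t j) (val t j.+1) (val t.+1 j)) ->
  control_ok (val T 0).1 -> (val T 0).1.2 = None ->
  (val 0 0).1.1 = (c.1, scan c) ->
  (forall j, j <= T -> (val 0 j).2 = row_of c j) ->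
  accepts c.
Proof.
move=> ok okT actT val00 val0.
suff gen m t c' : t + m = T -> (val t 0).1.1 = (c'.1, scan c') ->
    (forall j, j + t <= T -> (val t j).2 = row_of c' j) -> accepts c'.
  by apply: (gen T 0) => // j; rewrite addn0; apply: val0.
elim: m t c' => [|m IH] t c' tm ctl cells.
  move: okT; rewrite -tm addn0 in actT *; case: (val t 0).1 ctl actT => _ a /= -> ->.
  by case/control_ok_None => acc h; apply: accepts_halted.
have tT : t < T by lia.
have T0 : 0 < T by lia.
have same j : j <= T -> (val t j).1 = (val t 0).1.
  elim: j => // j IHj jT; have /and5P[_ _ /eqP-> _ _] := ok t j tT jT.
  by apply: IHj; lia.
set a := (val t 0).1.2.
have zE j : j <= T -> (val t j).1 = (c'.1, scan c', a).
  by move=> /same ->; rewrite -ctl /a; case: (val t 0).1.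
have /and5P[okz _ _ _ /= /eqP nxt] := ok t 0 tT T0.
rewrite zE // in okz nxt.
(* Action [None] before time [T] already certifies acceptance. *)
case aE: a => [p|]; rewrite aE in zE okz nxt; last first.
  by have [acc h] := (control_ok_None _).1 okz; apply: accepts_halted.
apply: (accepts_step (c' := next_config (Some p) c')).
  by apply/stepE; exists p.
apply: (IH t.+1); first by lia.
  by rewrite nxt next_scanE cells //; lia.
move=> j jt; have jT : j < T by lia.
have /and5P[_ _ _ /eqP -> _] := ok t j tT jT.
by rewrite next_rowE zE ?cells //; lia.
Qed.

(** An accepting run is prolonged forever by repeating its last configuration with action [None].
    The time bound ensures that this phase is reached by time [T]. *)
Lemma accepts_window_ok (T : nat) (c : config M) :
  halts_within T c -> accepts c ->
  exists val : nat -> nat -> cell,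
  [/\ forall t j, window_ok (j == 0)
        (val t j.-1) (val t j) (val t j.+1) (val t.+1 j),
      control_ok (val T 0).1, (val T 0).1.2 = None,
      forall j, (val 0 j).1.1 = (c.1, scan c) &
      forall j, (val 0 j).2 = row_of c j].
Proof.
move=> hw acc.
have [cs [a [cs0 csS ok]]] : exists (cs : nat -> config M) (a : nat -> action),
    [/\ cs 0 = c, forall t, cs t.+1 = next_config (a t) (cs t) &
        forall t, control_ok ((cs t).1, scan (cs t), a t)].
  elim: acc {hw} => {}c => [h|c' /stepE[p [okp ->]] _ [cs [a [cs0 csS ok]]]].
    move=> ac; exists (fun=> c), (fun=> None); split=> // _.
    exact/control_ok_None.
  exists (fun t => if t is t'.+1 then cs t' else c).
  exists (fun t => if t is t'.+1 then a t' else Some p).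
  by split=> // -[].
have aT : a T = None.
  have : halts_within T (cs 0) by rewrite cs0.
  (* After [None] the configuration is the same halted one, from which no step is possible. *)
  have aS t : a t = None -> a t.+1 = None.
    move=> at0; have := ok t.+1; rewrite csS at0 /=.
    have := ok t; rewrite at0 => /control_ok_None[_ h].
    case: (a t.+1) => // p okp; case: (h (next_config (Some p) (cs t))).
    by apply/stepE; exists p.
  have aD t s : a t = None -> a (t + s) = None.
    by move=> at0; elim: s => [|s IHs]; rewrite ?addn0 ?addnS //; apply: aS.
  (* As long as steps are taken, each lowers the time bound by one; at bound 0 the configuration is
     halted. *)
  move=> h; suff: forall s, halts_within (T - s) (cs s) -> s <= T -> a T = None.
    by move/(_ 0); rewrite subn0; apply.
  move=> s; move Em: (T - s) => m; elim: m s Em {h} => [|m IH] s Em h sT.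
    have -> : T = s by lia.
    case aE: (a s) => [p|] //; case: (h (next_config (Some p) (cs s))).
    by apply/stepE; exists p; rewrite -aE.
  case aE: (a s) => [p|]; last by rewrite -(subnKC sT) aD.
  apply: (IH s.+1); [lia| |lia].
  by apply: h; apply/stepE; exists p; rewrite -aE csS.
exists (fun t j => ((cs t).1, scan (cs t), a t, row_of (cs t) j)); split=> //=.
- move=> t j; apply/and5P; split=> //=; first by rewrite csS next_rowE.
  apply/implyP => /eqP->; rewrite csS next_scanE.
  by case: (a t) => [[]|].
- by move=> j; rewrite cs0.
- by move=> j; rewrite cs0.
Qed.

End Tableau.

(** * The tableau of a machine on an input with advice, as nogoods *)

Section Tableau_nogoods.

Variables (M : ntm (option bool)) (n : nat) (v : seq bool) (T : nat).

(** Position [j] of the pair string depends on the input at most through bit [j]. Filling the whole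
    input with [b] therefore gives the symbol at [j] for every input whose bit [j] is [b]. *)
Definition input_symbol (b : bool) (j : nat) : symbol M :=
  nth (blank M) (map (@letter _ M) (pair_string (nseq n b) v)) j.

Definition input_literal (j : nat) (b : bool) : seq (nat * bool) :=
  if j < n then [:: (j, b)] else [::].

Definition init_ok (s0 s1 : symbol M) (p : cell M) : bool :=
  (p.1.1 == (start M, [ffun i => if i == ord0 then s0 else blank M])) &&
  (p.2 == [ffun i => (blank M, if i == ord0 then s1 else blank M)]).

(** Cell [j] at time 0 depends on two positions of the pair string, the scanned position 0 and
    position [j.+1]. Each wrong content is forbidden for each value of the two bits; positions
    outside the input contribute no literal. *)
Definition init_nogoods : seq (nogood (cell M)) :=
  [seq (input_literal 0 i.1.1.2 ++ input_literal (nat_of_ord i.1.1.1).+1 i.1.2,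
        [:: (0, nat_of_ord i.1.1.1, i.2)])
  | i <- enum {: 'I_T.+1 * bool * bool * cell M}
  & ~~ init_ok (input_symbol i.1.1.2 0)
         (input_symbol i.1.2 (nat_of_ord i.1.1.1).+1) i.2].

Definition window_nogoods : seq (nogood (cell M)) :=
  [seq ([::], let: (t, j, (p1, p2, p3, p4)) := i in
        [:: (nat_of_ord t, j.-1, p1); (nat_of_ord t, nat_of_ord j, p2);
            (nat_of_ord t, j.+1, p3); (t.+1, nat_of_ord j, p4)])
  | i : 'I_T * 'I_T * (cell M * cell M * cell M * cell M) <- enum predT
  & let: (t, j, (p1, p2, p3, p4)) := i in
    ~~ window_ok (j == 0 :> nat) p1 p2 p3 p4].

Definition final_nogoods : seq (nogood (cell M)) :=
  [seq ([::], [:: (T, 0, p)])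
  | p <- enum {: cell M} & ~~ (control_ok p.1 && (p.1.2 == None))].

Definition tableau_nogoods : seq (nogood (cell M)) :=
  init_nogoods ++ window_nogoods ++ final_nogoods.

Lemma input_symbolE (w : seq bool) (b : bool) (j : nat) :
  size w = n -> (j < n -> nth false w j = b) ->
  input_symbol b j = nth (blank M) (map (@letter _ M) (pair_string w v)) j.
Proof.
move=> wn wb; rewrite /input_symbol /pair_string !map_cat !nth_cat.
rewrite !size_map size_nseq wn; case: ifP => // jn.
rewrite -!map_comp (nth_map false) ?size_nseq // (nth_map false) ?wn //.
by rewrite nth_nseq jn wb.
Qed.

Lemma input_literalE (w : seq bool) (j : nat) (b : bool) :
  all (satisfies w) (input_literal j b) = (j < n) ==> (nth false w j == b).
Proof. by rewrite /input_literal; case: ifP; rewrite //= andbT. Qed.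

Lemma init_okE (x : seq (option bool)) (j : nat) (p : cell M) :
  let s := nth (blank M) (map (@letter _ M) x) in
  init_ok (s 0) (s j.+1) p <->
  p.1.1 = ((init_config M x).1, scan (init_config M x)) /\
  p.2 = row_of (init_config M x) j.
Proof.
move=> s.
have -> : scan (init_config M x) =
    [ffun i => if i == ord0 then s 0 else blank M].
  by apply/ffunP => i; rewrite !ffunE /=; case: eqP => //; rewrite /s nth0.
have -> : row_of (init_config M x) j =
    [ffun i => (blank M, if i == ord0 then s j.+1 else blank M)].
  apply/ffunP => i; rewrite !ffunE /= nth_nil; case: eqP => _ /=.
    by rewrite nth_behead.
  by rewrite nth_nil.
by rewrite /init_ok; split=> [/andP[/eqP-> /eqP->]|[-> ->]]; rewrite ?eqxx.
Qed.

Lemma tableau_nogoodsP (w : seq bool) :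
  size w = n -> halts_within T (init_config M (pair_string w v)) ->
  (exists val, all (avoids w val) tableau_nogoods) <->
  accepts (init_config M (pair_string w v)).
Proof.
move=> wn hw; split=> [[val]|acc].
  rewrite !all_cat => /and3P[/allP okI /allP okW /allP okF].
  have init j : j <= T -> (val 0 j).1.1 =
        ((init_config M (pair_string w v)).1,
         scan (init_config M (pair_string w v))) /\
      (val 0 j).2 = row_of (init_config M (pair_string w v)) j.
    rewrite -ltnS => jT; apply/init_okE/negP => /negP bad.
    (* A wrong cell would itself index a nogood that [val] violates. The default [false] beyond the
       input does no harm, as there the list of literals is empty. *)
    pose i : 'I_T.+1 * bool * bool * cell M :=
      (Ordinal jT, nth false w 0, nth false w j.+1, val 0 j).
    have := okI _ (map_f _ (_ : i \in _)); rewrite mem_filter mem_enum /=.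
    rewrite !(input_symbolE (w := w)) // bad => /(_ isT).
    by rewrite /avoids /= all_cat !input_literalE !eqxx !implybT.
  have /andP[okT /eqP actT] : control_ok (val T 0).1 && ((val T 0).1.2 == None).
    apply/negP => /negP bad.
    have := okF _ (map_f _ (_ : val T 0 \in _)); rewrite mem_filter mem_enum.
    by rewrite bad => /(_ isT); rewrite /avoids /= eqxx.
  apply: (window_ok_accepts (T := T) (val := val)) => //.
  - move=> t j tT jT; apply/negP => /negP bad.
    pose i : 'I_T * 'I_T * (cell M * cell M * cell M * cell M) :=
      (Ordinal tT, Ordinal jT,
       (val t j.-1, val t j, val t j.+1, val t.+1 j)).
    have := okW _ (map_f _ (_ : i \in _)); rewrite mem_filter mem_enum /= bad.
    by move=> /(_ isT); rewrite /avoids /= !eqxx.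
  - by case: (init 0 (leq0n _)).
  - by move=> j /init[].
have [val [okW okT actT val1 val2]] := accepts_window_ok hw acc.
exists val; rewrite !all_cat; apply/and3P; split; apply/allP => g.
- case/mapP=> -[[[j b0] b1] p]; rewrite mem_filter /= => /andP[bad _] ->.
  rewrite /avoids all_cat !input_literalE /= andbT; apply/negP.
  move=> /andP[/andP[/implyP h0 /implyP h1] /eqP ve]; case/negP: bad.
  rewrite !(input_symbolE (w := w)) //; try by move=> jn; apply/eqP; auto.
  by apply/init_okE; rewrite -ve val1 val2.
- case/mapP=> -[[t j] [[[p1 p2] p3] p4]]; rewrite mem_filter /=.
  move=> /andP[bad _] ->; rewrite /avoids /= andbT; apply/negP.
  move=> /and4P[/eqP e1 /eqP e2 /eqP e3 /eqP e4]; case/negP: bad.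
  by rewrite -e1 -e2 -e3 -e4; apply: okW.
- case/mapP=> p; rewrite mem_filter => /andP[bad _] ->.
  rewrite /avoids /= andbT; apply/negP => /eqP e; case/negP: bad.
  by rewrite -e okT actT eqxx.
Qed.

Lemma tableau_nogoods_in_range : all (nogood_in_range n T) tableau_nogoods.
Proof.
have litP j b : all (fun l => l.1 < n) (input_literal j b).
  by rewrite /input_literal; case: ifP => //= ->.
rewrite !all_cat; apply/and3P; split; apply/allP => g /mapP[].
- move=> [[[j b0] b1] p] _ ->; rewrite /nogood_in_range all_cat !litP /= andbT.
  by rewrite -ltnS.
- move=> [[t j] [[[p1 p2] p3] p4]] _ ->; rewrite /nogood_in_range /=.
  by have := ltn_ord t; have := ltn_ord j; lia.
- by move=> p _ ->; rewrite /nogood_in_range /= leqnn.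
Qed.

Lemma tableau_nogoods_width :
  all (fun g : nogood (cell M) => size g.1 + size g.2 <= 4) tableau_nogoods.
Proof.
have litP j b : size (input_literal j b) <= 1.
  by rewrite /input_literal; case: ifP.
rewrite !all_cat; apply/and3P; split; apply/allP => g /mapP[].
- move=> [[[j b0] b1] p] _ -> /=; rewrite size_cat.
  by have := litP 0 b0; have := litP j.+1 b1; lia.
- by move=> [[t j] [[[p1 p2] p3] p4]] _ ->.
- by move=> p _ ->.
Qed.

Lemma size_tableau_nogoods :
  size tableau_nogoods <=
    T.+1 * 2 * 2 * #|{: cell M}|
    + (T * T * (#|{: cell M}| * #|{: cell M}| * #|{: cell M}| * #|{: cell M}|)
       + #|{: cell M}|).
Proof.
have filt (I : finType) (a : pred I) (X : Type) (h : I -> X) :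
    size (map h (seq.filter a (enum I))) <= #|I|.
  by rewrite size_map size_filter cardE count_size.
rewrite !size_cat; apply: leq_add; last apply: leq_add.
- by apply: leq_trans (filt _ _ _ _) _; rewrite !card_prod card_ord card_bool.
- by apply: leq_trans (filt _ _ _ _) _; rewrite !card_prod card_ord.
- exact: filt.
Qed.

End Tableau_nogoods.

(** * Containment of NP/poly in NP_IS *)

Lemma NP_poly_sub_NP_IS (F : seq bool -> bool) :
  NP_poly F -> exists2 f, NP_IS f & to_fun f = F.
Proof.
move=> [L [p [advice [[M [q [qpoly hw LM]]] ppoly advp FL]]]].
(* The machine reads the input, one separator and the advice. *)
pose T n := q (n + (size (advice n)).+1).
have Tpoly : poly_bounded T.
  apply: (poly_bounded_comp (poly_fun_bounded qpoly)).
  apply: poly_bounded_add; first exact: poly_bounded_id.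
  apply: (@poly_bounded_le _ (fun n => p n + 1)) => [n|].
    by rewrite addn1 ltnS.
  exact: poly_bounded_add (poly_fun_bounded ppoly) (poly_bounded_const 1).
have T1poly : poly_bounded (fun n => (T n).+1).
  apply: (@poly_bounded_le _ (fun n => T n + 1)) => [n|]; first by rewrite addn1.
  exact: poly_bounded_add Tpoly (poly_bounded_const 1).
have hwT n w : size w = n ->
    halts_within (T n) (init_config M (pair_string w (advice n))).
  move=> wn; have := hw (pair_string w (advice n)).
  by rewrite /pair_string size_cat /= !size_map wn.
pose cnf n := nogood_cnf n (T n) (tableau_nogoods M n (advice n) (T n)).
have [k kb] : poly_bounded (fun n => nbits (cell M) (T n)).
  by repeat apply: poly_bounded_mul => //; exact: poly_bounded_const.
(* A monotone polynomial that is at least the number of grid bits; surplus certificate bits occur in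
   no clause. *)
pose H n := n.+2 ^ k.
(* A family must be defined at every length. As [n + H n] is strictly increasing, a length [m]
   determines at most one formula; at lengths without one, [g] is constantly [false]. *)
pose g : Defs.family := fun m x =>
  `[< exists2 n, m = n + H n & all (has (satisfies x)) (cnf n) >].
have Hinj n n' : n + H n = n' + H n' -> n = n'.
  case: (ltngtP n n') => // nn' e.
    by have := homo_leq_expn k (ltnW nn'); rewrite -/(H n) -/(H n'); lia.
  by have := homo_leq_expn k (ltnW nn'); rewrite -/(H n) -/(H n'); lia.
have gE n x : g (n + H n) x = all (has (satisfies x)) (cnf n).
  by apply/asboolP/idP => [[n' /Hinj e]|]; [rewrite (congr1 cnf e) | exists n].
have [l lb] : poly_bounded (fun n => size (cnf_code (cnf n))).
  apply: poly_bounded_le => [n|].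
    exact: leq_trans (size_nogood_cnf n (T n) (tableau_nogoods_width _ _ _ _))
      (leq_add (leq_mul (leq_add (leqnn _) (size_tableau_nogoods _ _ _ _))
        (leqnn _)) (leqnn _)).
  by repeat (apply: poly_bounded_add || apply: poly_bounded_mul) => //;
    exact: poly_bounded_const.
exists (fun n w => F w); last first.
  by apply/funext => w.
exists H, g; split.
- exact: poly_fun_expn.
- exact: homo_leq_expn.
- exists (fun m => m.+2 ^ l); split; first exact: poly_fun_expn.
  move=> m; have [[n mE]|no] := pselect (exists n, m = n + H n).
    exists (cnf_code (cnf n)); split; first exact: cnf_code_br.
      rewrite mE => x.
      have [|r [rE rO]] := @exec_cnf_code x (cnf n); last first.
        by exists r; rewrite gE.
      apply: nogood_cnf_in_range (tableau_nogoods_in_range _ _ _ _).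
      by rewrite size_tuple leq_add2l.
    apply: leq_trans (lb n) _; apply: homo_leq_expn; lia.
  (* At the remaining lengths [out] keeps its initial value [false]. *)
  exists [:: Term]; split => //.
    move=> x; eexists; split => //=; congr Some.
    by apply/esym/asboolP => -[n mE _]; apply: no; exists n.
  by rewrite expn_gt0.
- move=> n w; rewrite FL size_tuple LM.
  rewrite -(tableau_nogoodsP (size_tuple w) (hwT _ _ (size_tuple w))).
  rewrite -(nogood_cnf_sat (H := H n) (size_tuple w) (kb n)
              (tableau_nogoods_in_range _ _ _ _)).
  by split=> -[c]; rewrite ?gE => cE; exists c; rewrite ?gE.
Qed.

(** * The one-pass interpreter *)

(** [MSet] writes only if the accumulator is [true]. This replaces branching: the code of an
    instruction that control does not reach runs without effect. *)
Inductive mem_op := MLoad | MAnd of bool | MSet of bool.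

Inductive op := OLeft | ORight | OGuess | OMem of mem_op.

Definition mem_op_effect (o : mem_op) (acc y : bool) : bool * bool :=
  match o with
  | MLoad => (y, y)
  | MAnd b => (acc && (y == b), y)
  | MSet b => (acc, if acc then b else y)
  end.

Definition op_effect (guess : bool) (o : op) (acc y : bool) :
    bool * bool * move :=
  match o with
  | OLeft => (acc, y, MoveLeft)
  | ORight => (acc, y, MoveRight)
  | OGuess => (acc, guess, Stay)
  | OMem o => (mem_op_effect o acc y, Stay)
  end.

Definition op_decode (j : nat) : op :=
  match j with
  | 0 => OLeft
  | 1 => ORight
  | 2 => OGuess
  | 3 => OMem MLoad
  | 4 => OMem (MAnd false)
  | 5 => OMem (MAnd true)
  | 6 => OMem (MSet false)
  | _ => OMem (MSet true)
  end.

Definition op_number (o : op) : nat :=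
  match o with
  | OLeft => 0
  | ORight => 1
  | OGuess => 2
  | OMem MLoad => 3
  | OMem (MAnd b) => 4 + b
  | OMem (MSet b) => 6 + b
  end.

(** A unary code, so that decoding amounts to counting in ['I_8]. *)
Definition op_bits (o : op) : seq bool := rcons (nseq (op_number o) true) false.

Definition prog_bits (P : seq op) : seq bool := flatten (map op_bits P).

(* [None] while the input proper is being copied; then the accumulator and the
   number of [true]s read of the present operation. *)
Definition interp_state : Type := option (bool * 'I_8).
HB.instance Definition _ := Finite.on interp_state.

Definition interp_next (guess : bool) (q : interp_state) (a : option bool)
    (y : bool) : interp_state * bool * move :=
  match q, a with
  | None, Some b => (None, b, MoveRight)
  | _, None => (Some (true, ord0), y, Stay)
  | Some (acc, j), Some true => (Some (acc, ordS j), y, Stay)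
  | Some (acc, j), Some false =>
      let: (acc', y', d) := op_effect guess (op_decode j) acc y in
      (Some (acc', ord0), y', d)
  end.

Definition interp_accepting (q : interp_state) : bool :=
  if q is Some (acc, _) then acc else false.

Definition interp_symbol : Type := option (option bool).
HB.instance Definition _ := Finite.on interp_symbol.

(** Blank cells count as [false], the initial value of auxiliary registers, [out] and flags. *)
Definition cell_bit (x : interp_symbol) : bool := x == Some (Some true).

Definition interp_action (x : interp_symbol) (b : bool) (d : move) :
    {ffun 'I_2 -> interp_symbol * move} :=
  [ffun i => if i == ord0 then (x, MoveRight) else (Some (Some b), d)].

(** Each step reads one letter, and the machine halts exactly when it scans a blank on the input
    tape; so the length of the input bounds the running time. *)
Definition interp_delta (q : interp_state) (s : {ffun 'I_2 -> interp_symbol})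
    (q' : interp_state) (a : {ffun 'I_2 -> interp_symbol * move}) : bool :=
  if s ord0 is Some x then
    `[< exists guess,
        let n := interp_next guess q x (cell_bit (s ord_max)) in
        q' = n.1.1 /\ a = interp_action (s ord0) n.1.2 n.2 >]
  else false.

Lemma interp_letter_blank (x : option bool) : Some x != None :> interp_symbol.
Proof. by []. Qed.

Definition interpreter : ntm (option bool) :=
  @NTM (option bool) 1 interp_state interp_symbol None Some
    (@Some_inj _) interp_letter_blank None interp_accepting interp_delta.

Definition interp_config (q : interp_state) (l : seq interp_symbol)
    (xs : seq (option bool)) (t : tape interp_symbol) : config interpreter :=
  (q, [ffun i => if i == ord0
                 then (l, head None (map Some xs), behead (map Some xs))
                 else t]).

(** * Abstract runs of the interpreter *)

Definition upd (I : eqType) (m : I -> bool) (a : I) (b : bool) : I -> bool :=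
  fun x => if x == a then b else m x.

Lemma upd_id (I : eqType) (m : I -> bool) (a : I) : upd m a (m a) = m.
Proof. by apply/funext => x; rewrite /upd; case: eqP => // ->. Qed.

Definition move_pos (d : move) (z : int) : int :=
  match d with MoveLeft => z - 1 | Stay => z | MoveRight => z + 1 end%R.

(** The memory tape becomes a function on the integers with a head position, the input tape the list
    of unread letters, and nondeterminism an existential quantifier over guesses. *)
Fixpoint interp_accepts (q : interp_state) (m : int -> bool) (z : int)
    (xs : seq (option bool)) : Prop :=
  if xs is x :: xs' then
    exists guess, let n := interp_next guess q x (m z) in
      interp_accepts n.1.1 (upd m z n.1.2) (move_pos n.2 z) xs'
  else interp_accepting q.

Definition tape_holds (t : tape interp_symbol) (m : int -> bool) (z : int) : Prop :=
  [/\ forall j : nat, cell_bit (nth None t.1.1 j) = m (z - 1 - j%:Z)%R,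
      cell_bit t.1.2 = m z &
      forall j : nat, cell_bit (nth None t.2 j) = m (z + 1 + j%:Z)%R].

Lemma tape_holds_write_move (t : tape interp_symbol) (m : int -> bool) (z : int)
    (b : bool) (d : move) :
  tape_holds t m z ->
  tape_holds (write_move None (Some (Some b), d) t) (upd m z b) (move_pos d z).
Proof.
have bE : cell_bit (Some (Some b)) = b by case: b.
case: t => [[l s] r] [/= Hl Hs Hr]; case: d; split => /=.
- move=> j; rewrite nth_behead Hl /upd ifN; last lia.
  by congr m; lia.
- rewrite -nth0 Hl /upd ifN; last lia.
  by congr m; lia.
- case=> [|j] /=; rewrite /upd; first by rewrite bE ifT //; lia.
  rewrite Hr ifN; last lia.
  by congr m; lia.
- by move=> j; rewrite Hl /upd ifN //; lia.
- by rewrite /upd eqxx.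
- by move=> j; rewrite Hr /upd ifN //; lia.
- case=> [|j] /=; rewrite /upd; first by rewrite bE ifT //; lia.
  rewrite Hl ifN; last lia.
  by congr m; lia.
- rewrite -nth0 Hr /upd ifN; last lia.
  by congr m; lia.
- move=> j; rewrite nth_behead Hr /upd ifN; last lia.
  by congr m; lia.
Qed.

Lemma step_interp_config (q : interp_state) (l : seq interp_symbol)
    (x : option bool) (xs : seq (option bool)) (t : tape interp_symbol)
    (c : config interpreter) :
  step (interp_config q l (x :: xs) t) c <->
  exists guess, let n := interp_next guess q x (cell_bit t.1.2) in
    c = interp_config n.1.1 (Some x :: l) xs
          (write_move None (Some (Some n.1.2), n.2) t).
Proof.
have s0 : [ffun i => scanned ((interp_config q l (x :: xs) t).2 i)] ord0 = Some x
  by rewrite !ffunE.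
have s1 : [ffun i => scanned ((interp_config q l (x :: xs) t).2 i)] ord_max = t.1.2.
  by rewrite !ffunE.
split=> [[a []]|[guess ->]].
  rewrite /= /interp_delta s0 s1 => /asboolP[guess [qE ->]] cE; exists guess.
  rewrite /interp_config [c]surjective_pairing qE cE; congr pair.
  by apply/ffunP => i; rewrite !ffunE; case: eqP.
set n := interp_next _ _ _ _.
exists (interp_action (Some x) n.1.2 n.2); split.
  by rewrite /= /interp_delta s0 s1; apply/asboolP; exists guess.
by apply/ffunP => i; rewrite !ffunE; case: eqP.
Qed.

Lemma halted_interp_config (q : interp_state) (l : seq interp_symbol)
    (t : tape interp_symbol) : halted (interp_config q l [::] t).
Proof. by move=> c [a []]; rewrite /= /interp_delta !ffunE. Qed.

Lemma interp_halts (q : interp_state) (l : seq interp_symbol)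
    (xs : seq (option bool)) (t : tape interp_symbol) :
  halts_within (size xs) (interp_config q l xs t).
Proof.
elim: xs q l t => [|x xs IH] q l t; first exact: halted_interp_config.
by move=> c /step_interp_config[guess ->]; apply: IH.
Qed.

Lemma accepts_inv (S : finType) (M : ntm S) (c : config M) :
  accepts c ->
  halted c /\ accepting c.1 \/ exists2 c', step c c' & accepts c'.
Proof. by case=> [|c1 c2]; [left | right; exists c2]. Qed.

Lemma accepts_interp_config (q : interp_state) (l : seq interp_symbol)
    (xs : seq (option bool)) (t : tape interp_symbol) (m : int -> bool) (z : int) :
  tape_holds t m z ->
  accepts (interp_config q l xs t) <-> interp_accepts q m z xs.
Proof.
elim: xs q l t m z => [|x xs IH] q l t m z tm /=.
  split=> [/accepts_inv[[_ //]|[c sc]]|acc].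
    by case: (halted_interp_config sc).
  exact: (accepts_halted (@halted_interp_config q l t) acc).
have tz : cell_bit t.1.2 = m z by case: tm.
split=> [/accepts_inv[[h _]|[c /step_interp_config[guess ->] acc]]|[guess acc]].
- exfalso; apply: h; apply/step_interp_config.
  by exists false.
- rewrite tz in acc; exists guess.
  exact: (IH _ _ _ _ _ (tape_holds_write_move _ _ tm)).1 acc.
- apply: accepts_step; first by apply/step_interp_config; exists guess.
  by rewrite tz; apply: (IH _ _ _ _ _ (tape_holds_write_move _ _ tm)).2 acc.
Qed.

Lemma init_interpreter (x : seq (option bool)) :
  init_config interpreter x = interp_config None [::] x ([::], None, [::]).
Proof.
congr pair; apply/ffunP => i; rewrite !ffunE.
by case: eqP.
Qed.

Lemma interpreter_NP :
  NP [set x | accepts (init_config interpreter x)].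
Proof.
exists interpreter, id; split=> //.
  by exists 'X%R => n; rewrite hornerX.
by move=> x; rewrite init_interpreter; apply: interp_halts.
Qed.

Lemma accepts_interpreter (x : seq (option bool)) :
  accepts (init_config interpreter x) <->
  interp_accepts None (fun=> false) 0 x.
Proof.
rewrite init_interpreter; apply: accepts_interp_config.
by split=> // j; rewrite nth_nil.
Qed.

(** * Runs of lists of operations *)

Definition ready (acc : bool) : interp_state := Some (acc, ord0).

Definition op_letters (P : seq op) : seq (option bool) := map Some (prog_bits P).

Lemma op_letters_cat (P Q : seq op) :
  op_letters (P ++ Q) = op_letters P ++ op_letters Q.
Proof. by rewrite /op_letters /prog_bits map_cat flatten_cat map_cat. Qed.

Lemma interp_accepts_tick (acc : bool) (j : 'I_8) (m : int -> bool) (z : int)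
    (xs : seq (option bool)) :
  interp_accepts (Some (acc, j)) m z (Some true :: xs) <->
  interp_accepts (Some (acc, ordS j)) m z xs.
Proof.
(* The guess has no influence here, so any bit is a witness. *)
by rewrite /= upd_id; split=> [[]|acc'] //; exists false.
Qed.

Lemma interp_accepts_op (o : op) (acc : bool) (m : int -> bool) (z : int)
    (xs : seq (option bool)) :
  interp_accepts (ready acc) m z (op_letters [:: o] ++ xs) <->
  exists guess, let n := op_effect guess o acc (m z) in
    interp_accepts (ready n.1.1) (upd m z n.1.2) (move_pos n.2 z) xs.
Proof.
rewrite /ready /op_letters /prog_bits /= cats0.
case: o => [|||[|[]|[]]]; rewrite /op_bits map_rcons map_nseq cat_rcons [nseq _ _]/=;
  rewrite ?[(_ :: _) ++ _]/= ?interp_accepts_tick //=.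
Qed.

(** Programs address only the cells from the origin on; all others stay [false]. *)
Definition lift_mem (m : nat -> bool) (z : int) : bool :=
  if z is Posz a then m a else false.

Lemma upd_lift_mem (m : nat -> bool) (a : nat) (b : bool) :
  upd (lift_mem m) (Posz a) b = lift_mem (upd m a b).
Proof. by apply/funext => -[x|x]; rewrite /upd. Qed.

(** Subtraction is truncated, so one of the two lists is empty. *)
Definition goto (p a : nat) : seq op := nseq (p - a) OLeft ++ nseq (a - p) ORight.

Lemma interp_accepts_goto (p a : nat) (acc : bool) (m : int -> bool)
    (xs : seq (option bool)) :
  interp_accepts (ready acc) m (Posz p) (op_letters (goto p a) ++ xs) <->
  interp_accepts (ready acc) m (Posz a) xs.
Proof.
have L k z ys : interp_accepts (ready acc) m z (op_letters (nseq k OLeft) ++ ys) <->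
    interp_accepts (ready acc) m (z - k%:Z)%R ys.
  elim: k z => [|k IH] z; first by rewrite subr0.
  rewrite -[k.+1]add1n nseqD op_letters_cat -catA interp_accepts_op /= upd_id.
  have -> : (z - (1 + k)%N%:Z = z - 1 - k%:Z)%R by lia.
  by rewrite -IH; split=> [[]|] //; exists false.
have R k z ys : interp_accepts (ready acc) m z (op_letters (nseq k ORight) ++ ys) <->
    interp_accepts (ready acc) m (z + k%:Z)%R ys.
  elim: k z => [|k IH] z; first by rewrite addr0.
  rewrite -[k.+1]add1n nseqD op_letters_cat -catA interp_accepts_op /= upd_id.
  have -> : (z + (1 + k)%N%:Z = z + 1 + k%:Z)%R by lia.
  by rewrite -IH; split=> [[]|] //; exists false.
rewrite /goto op_letters_cat -catA L R.
by have -> : (p%:Z - (p - a)%N%:Z + (a - p)%N%:Z = a%:Z)%R by lia.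
Qed.

(** * Straight-line programs and their compilation *)

Definition line : Type := (mem_op * nat)%type.

Definition run_line (s : bool * (nat -> bool)) (i : line) : bool * (nat -> bool) :=
  match i.1 with
  | MLoad => (s.2 i.2, s.2)
  | MAnd b => (s.1 && (s.2 i.2 == b), s.2)
  | MSet b => (s.1, if s.1 then upd s.2 i.2 b else s.2)
  end.

Definition run (P : seq line) (s : bool * (nat -> bool)) := foldl run_line s P.

(** [p] is the head position before the program. After each line the head stands at the address of
    that line, whatever the data, so all moves are known in advance. *)
Fixpoint compile (p : nat) (P : seq line) : seq op :=
  if P is (o, a) :: P' then goto p a ++ OMem o :: compile a P' else [::].

Lemma interp_accepts_compile (P : seq line) (p : nat) (acc : bool)
    (m : nat -> bool) :
  interp_accepts (ready acc) (lift_mem m) (Posz p) (op_letters (compile p P)) <->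
  (run P (acc, m)).1.
Proof.
elim: P p acc m => [|[o a] P IH] p acc m //=.
rewrite op_letters_cat interp_accepts_goto -cat1s op_letters_cat interp_accepts_op.
have E g : let n := op_effect g (OMem o) acc (m a) in
    (n.1.1, upd m a n.1.2) = run_line (acc, m) (o, a).
  by case: o => [|b|b]; rewrite /run_line /= ?upd_id //; case: acc; rewrite ?upd_id.
rewrite /= -(E false) -(IH a) upd_lift_mem.
by split=> [[]|] //; exists false.
Qed.

Fixpoint write_mem (m : nat -> bool) (p : nat) (c : seq bool) : nat -> bool :=
  if c is b :: c' then write_mem (upd m p b) p.+1 c' else m.

Lemma write_mem_cat (m : nat -> bool) (p : nat) (c d : seq bool) :
  write_mem m p (c ++ d) = write_mem (write_mem m p c) (p + size c) d.
Proof.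
elim: c m p => [|b c IH] m p /=; first by rewrite addn0.
by rewrite IH addSnnS.
Qed.

Lemma write_memE (m : nat -> bool) (p : nat) (c : seq bool) (a : nat) :
  write_mem m p c a = if p <= a < p + size c then nth false c (a - p) else m a.
Proof.
elim: c m p => [|b c IH] m p /=; first by rewrite ifN //; lia.
rewrite IH /upd; case: (ltngtP p a) => pa /=.
- rewrite addSnnS; case: ifP => // _.
  by rewrite -[a - p]/(a.+1 - p.+1) subSn.
- by [].
- by rewrite pa subnn addnS ltnS leq_addr.
Qed.

Lemma interp_accepts_copy (w : seq bool) (p : nat) (m : nat -> bool)
    (xs : seq (option bool)) :
  interp_accepts None (lift_mem m) (Posz p) (map Some w ++ xs) <->
  interp_accepts None (lift_mem (write_mem m p w)) (Posz (p + size w)) xs.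
Proof.
elim: w p m => [|b w IH] p m /=; first by rewrite addn0.
rewrite upd_lift_mem addnS -addSn -IH.
have -> : (p%:Z + 1 = p.+1%:Z)%R by lia.
by split=> [[]|] //; exists false.
Qed.

Definition guess_ops (k : nat) : seq op := flatten (nseq k [:: OGuess; ORight]).

Lemma interp_accepts_guess (k p : nat) (acc : bool) (m : nat -> bool)
    (xs : seq (option bool)) :
  interp_accepts (ready acc) (lift_mem m) (Posz p) (op_letters (guess_ops k) ++ xs) <->
  exists c : k.-tuple bool,
    interp_accepts (ready acc) (lift_mem (write_mem m p c)) (Posz (p + k)) xs.
Proof.
elim: k p m => [|k IH] p m.
  rewrite addn0; split=> [H|[c]]; first by exists [tuple].
  by rewrite tuple0.
rewrite -[guess_ops k.+1]/([:: OGuess] ++ [:: ORight] ++ guess_ops k).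
rewrite op_letters_cat -catA interp_accepts_op.
rewrite op_letters_cat -catA addnS -addSn.
have E g : interp_accepts (ready acc) (upd (lift_mem m) (Posz p) g) (Posz p)
      (op_letters [:: ORight] ++ op_letters (guess_ops k) ++ xs) <->
    exists c : k.-tuple bool, interp_accepts (ready acc)
      (lift_mem (write_mem (upd m p g) p.+1 c)) (Posz (p.+1 + k)) xs.
  rewrite -IH interp_accepts_op /= upd_id upd_lift_mem.
  have -> : (p%:Z + 1 = p.+1%:Z)%R by lia.
  by split=> [[]|] //; exists false.
split=> [[g /E[c H]]|[c]].
  by exists [tuple of g :: c].
by case/tupleP: c => g c H; exists g; apply/E; exists c.
Qed.

(** Copying the input leaves the head at [n]. The guessed certificate thus comes directly behind the
    input, and the program starts with the head at [n + H]. *)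
Definition advice_ops (n H : nat) (P : seq line) : seq op :=
  guess_ops H ++ compile (n + H) P.

Lemma accepts_advice (n H : nat) (P : seq line) (w : n.-tuple bool) :
  accepts (init_config interpreter (pair_string w (prog_bits (advice_ops n H P)))) <->
  exists c : H.-tuple bool, (run P (true, nth false (w ++ c))).1.
Proof.
rewrite accepts_interpreter /pair_string.
have -> : (fun=> false) = lift_mem (fun=> false) by apply/funext => -[].
rewrite interp_accepts_copy add0n size_tuple /= upd_id.
rewrite -/(op_letters _) op_letters_cat -/(ready true).
(* Cells not yet written hold [false], which is also the default of [nth] beyond the word. *)
have nthE (c : H.-tuple bool) :
    write_mem (write_mem (fun=> false) 0 w) n c = nth false (w ++ c).
  rewrite -{2}(size_tuple w) -(add0n (size w)) -write_mem_cat.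
  apply/funext => a; rewrite write_memE subn0 /=; case: ltnP => // ac.
  by rewrite nth_default.
split=> [[_ /interp_accepts_guess[c /interp_accepts_compile]]|[c H']].
  by rewrite nthE; exists c.
exists false; apply/interp_accepts_guess; exists c; apply/interp_accepts_compile.
by rewrite nthE.
Qed.

Lemma size_prog_bits (P : seq op) : size (prog_bits P) <= 8 * size P.
Proof.
elim: P => [|o P IH] //; rewrite /prog_bits /= size_cat -/(prog_bits P) mulnS.
by apply: leq_add => //; case: o => [|||[|[]|[]]].
Qed.

Lemma size_compile (A p : nat) (P : seq line) :
  p <= A -> all (fun i : line => i.2 <= A) P -> size (compile p P) <= A.+1 * size P.
Proof.
elim: P p => [|[o a] P IH] p //= pA /andP[aA PA].
by rewrite size_cat /goto size_cat !size_nseq /= mulnS; have := IH a aA PA; lia.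
Qed.

Lemma size_advice_ops (A n H : nat) (P : seq line) :
  n + H <= A -> all (fun i : line => i.2 <= A) P ->
  size (prog_bits (advice_ops n H P)) <= 8 * (H * 2 + A.+1 * size P).
Proof.
move=> nA PA; apply: leq_trans (size_prog_bits _) _; rewrite leq_mul2l /=.
rewrite size_cat leq_add ?size_compile // size_flatten /shape map_nseq sumn_nseq.
by rewrite mulnC.
Qed.

(** * Instruction sequences as straight-line programs *)

Definition instr_focus (u : instr) : option focus :=
  match u with
  | Plain a | PosTest a | NegTest a => Some a.1
  | Jump _ | Term => None
  end.

(* Registers are renumbered, since the size of an instruction sequence does not
   bound their numbers. *)
Definition foci (n : nat) (X : seq instr) : seq focus :=
  [seq Input i.+1 | i <- iota 0 n] ++ Out :: pmap instr_focus X.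

Section Straight_line.

Variable R : seq focus.

Definition address (f : focus) : nat := index f R.

(* The flag of instruction [p] says that control reaches it. *)
Definition flag (p : nat) : nat := size R + p.

Definition basic_lines (a : basic) : seq line :=
  if a.2 is Set_ b then [:: (MSet b, address a.1)] else [::].

(** The reply of each method is the content afterwards, so it can be read from the register. The
    flag is loaded a second time because the first comparison has changed the accumulator. *)
Definition test_lines (p : nat) (b : bool) (a : focus) : seq line :=
  [:: (MAnd b, address a); (MSet true, flag p.+1); (MLoad, flag p);
      (MAnd (~~ b), address a); (MSet true, flag p.+2)].

(* [s] is the number of instructions after [u]; farther jumps end in inaction. *)
Definition instr_lines (p s : nat) (u : instr) : seq line :=
  match u with
  | Plain a => (MLoad, flag p) :: basic_lines a ++ [:: (MSet true, flag p.+1)]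
  | PosTest a => (MLoad, flag p) :: basic_lines a ++ test_lines p true a.1
  | NegTest a => (MLoad, flag p) :: basic_lines a ++ test_lines p false a.1
  | Jump l =>
      if 0 < l <= s then [:: (MLoad, flag p); (MSet true, flag (p + l))]
      else [::]
  | Term => [::]
  end.

Fixpoint seq_lines (p : nat) (X : seq instr) : seq line :=
  if X is u :: X' then instr_lines p (size X') u ++ seq_lines p.+1 X' else [::].

Definition holds (m : nat -> bool) (r : registers) : Prop :=
  forall f b, f \in R -> r f = Some b -> m (address f) = b.

(** Flags before [p] stay raised but are not read by the lines for later instructions, so only those
    from [p] on are constrained. *)
Definition control_at (m : nat -> bool) (p : nat) (k : option nat) : Prop :=
  forall j, m (flag (p + j)) = (k == Some j).

Lemma run_cat (P Q : seq line) (s : bool * (nat -> bool)) :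
  run (P ++ Q) s = run Q (run P s).
Proof. exact: foldl_cat. Qed.

Lemma run_load (a : nat) (P : seq line) (acc : bool) (m : nat -> bool) :
  run ((MLoad, a) :: P) (acc, m) = run P (m a, m).
Proof. by []. Qed.

Lemma address_lt (f : focus) : f \in R -> address f < size R.
Proof. by rewrite /address index_mem. Qed.

Lemma address_inj (f g : focus) :
  f \in R -> g \in R -> address f = address g -> f = g.
Proof.
by move=> fR gR e; rewrite -(nth_index Out fR) -(nth_index Out gR); congr nth.
Qed.

(** Each write is preceded by a load of the flag, and between the two the accumulator can only be
    lowered; so it is [false] at every write. *)
Lemma instr_lines_idle (p s : nat) (u : instr) (acc : bool) (m : nat -> bool) :
  m (flag p) = false -> (run (instr_lines p s u) (acc, m)).2 = m.
Proof.
move=> mp; case: u => [[f o]|[f o]|[f o]|l|] //=; last by case: ifP; rewrite /run_line /= ?mp.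
- by rewrite /run_line /= mp; case: o => [b|]; rewrite /run_line /= ?mp.
- by rewrite /run_line /= mp; case: o => [b|]; rewrite /run_line /= ?mp.
- by rewrite /run_line /= mp; case: o => [b|]; rewrite /run_line /= ?mp.
Qed.

Lemma seq_lines_idle (X : seq instr) (p : nat) (s : bool * (nat -> bool)) :
  control_at s.2 p None -> (run (seq_lines p X) s).2 = s.2.
Proof.
elim: X p s => [|u X IH] p [acc m] c //=; rewrite run_cat.
have c0 : m (flag p) = false by have := c 0; rewrite addn0.
have e := instr_lines_idle (size X) u acc c0.
by rewrite IH e // => j; rewrite addSnnS; apply: c.
Qed.

Lemma run_basic_lines (f : focus) (o : meth) (m : nat -> bool)
    (r r' : registers) (b : bool) :
  f \in R -> holds m r -> exec_basic (f, o) r = Some (r', b) ->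
  exists m', [/\ run (basic_lines (f, o)) (true, m) = (true, m'),
    holds m' r', m' (address f) = b & forall x, size R <= x -> m' x = m x].
Proof.
move=> uf mr /=; case rf: (r f) => [c|] // [<- <-].
exists (upd m (address f) (if o is Set_ b' then b' else c)); split.
- case: o => [b'|] //=; rewrite /run /=; congr pair.
  by rewrite -(mr _ _ uf rf) upd_id.
- move=> g d ug; rewrite /update /upd; case: focus_eqbP => [<-|fg].
    by rewrite eqxx => -[].
  by rewrite ifN; [exact: mr | apply/eqP => /(address_inj ug uf) e; case: fg].
- by rewrite /upd eqxx.
- by move=> x Rx; rewrite /upd ifN //; have := address_lt uf; lia.
Qed.

(** With control at [p], all later flags are clear, so raising a single one passes control there. *)
Lemma control_at_upd (m m' : nat -> bool) (p j : nat) :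
  control_at m p (Some 0) -> (forall x, size R <= x -> m' x = m x) ->
  control_at (upd m' (flag (p.+1 + j)) true) p.+1 (Some j).
Proof.
move=> c mm' i; rewrite /upd /flag eqn_add2l eqn_add2l eq_sym.
rewrite [RHS](_ : _ = (j == i)) //; case: eqP => // _.
by rewrite mm' ?leq_addr // addSnnS; apply: c.
Qed.

Lemma holds_upd (m : nat -> bool) (r : registers) (p : nat) (b : bool) :
  holds m r -> holds (upd m (flag p) b) r.
Proof.
move=> mr f d uf rf; rewrite /upd ifN; first exact: mr.
by have := address_lt uf; rewrite /flag; lia.
Qed.

Lemma run_test_lines (p : nat) (b : bool) (f : focus) (m : nat -> bool) :
  f \in R -> m (flag p) ->
  (run (test_lines p b f) (true, m)).2 =
  upd m (flag (p.+1 + (if m (address f) == b then 0 else 1))) true.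
Proof.
move=> /address_lt fR mp; rewrite /run /run_line /=.
case: (boolP (m (address f) == b)) => /= mf.
  have -> : upd m (flag p.+1) true (address f) = m (address f).
    by rewrite /upd ifN // /flag; lia.
  by rewrite (eqP mf) addn0; case: b {mf}; rewrite andbF.
by rewrite mp addn1 /=; move: mf; case: (m _) b => [] [].
Qed.

(** In a terminating execution no jump leads behind the end, so the range check for jumps in
    [instr_lines] succeeds. *)
Lemma exec_lt_size (X : seq instr) (k : nat) (r r' : registers) :
  exec k X r = Some r' -> k < size X.
Proof. by elim: X k => [|u X IH] [|k] //= /IH. Qed.

(** Induction on [X]: the lines of an instruction before position [k] are idle, and those of the
    instruction at [k] update its register and raise the flag of its successor. *)
Lemma run_seq_lines (X : seq instr) (p k : nat) (r r' : registers)
    (s : bool * (nat -> bool)) :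
  all (mem R) (pmap instr_focus X) -> exec k X r = Some r' ->
  control_at s.2 p (Some k) -> holds s.2 r ->
  holds (run (seq_lines p X) s).2 r'.
Proof.
elim: X p k r s => [|u X IH] p k r [acc m] //= uX + c mr; rewrite run_cat.
have uX' : all (mem R) (pmap instr_focus X).
  by move: uX; case: instr_focus => //= f /andP[].
case: k c => [|k] c ex; last first.
  have c0 : m (flag p) = false by have := c 0; rewrite addn0.
  have e := instr_lines_idle (size X) u acc c0.
  apply: IH ex _ _; rewrite // e // => j.
  by rewrite addSnnS; apply: c.
have c0 : m (flag p) by have := c 0; rewrite addn0.
(* Both kinds of test at once: the next instruction is skipped unless the reply is [b], with [b]
   [false] for [NegTest]. *)
have testP f o b : f \in R ->
    (if exec_basic (f, o) r is Some (r1, b')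
     then exec (if b' == b then 0 else 1) X r1 else None) = Some r' ->
    holds (run (seq_lines p.+1 X)
      (run ((MLoad, flag p) :: basic_lines (f, o) ++ test_lines p b f)
        (acc, m))).2 r'.
  move=> uf; case bE: exec_basic => [[r1 b1]|] // ex1.
  have [m1 [run1 mr1 mf mm1]] := run_basic_lines uf mr bE.
  have m1p : m1 (flag p) by rewrite mm1 // leq_addr.
  have e : (run ((MLoad, flag p) :: basic_lines (f, o) ++ test_lines p b f)
      (acc, m)).2 =
      upd m1 (flag (p.+1 + (if b1 == b then 0 else 1))) true.
    rewrite run_load c0 run_cat run1.
    by rewrite run_test_lines // mf.
  apply: IH ex1 _ _; rewrite // e; last exact: holds_upd.
  exact: control_at_upd c mm1.
case: u uX ex => [[f o]|[f o]|[f o]|l|] /=.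
- move=> /andP[uf _]; case bE: (exec_basic (f, o) r) => [[r1 b1]|];
    rewrite /= in bE; rewrite bE // => ex1.
  have [m1 [run1 mr1 mf mm1]] := run_basic_lines uf mr bE.
  have e : (run ((MLoad, flag p) :: basic_lines (f, o)
      ++ [:: (MSet true, flag p.+1)]) (acc, m)).2 =
      upd m1 (flag (p.+1 + 0)) true.
    by rewrite run_load c0 run_cat run1 addn0.
  apply: IH ex1 _ _; rewrite // e; last exact: holds_upd.
  exact: control_at_upd c mm1.
- move=> /andP[uf _] ex; refine (testP f o true uf _).
  by move: ex => /=; case: (r f) => [[]|] //; case: (o) => [[]|].
- move=> /andP[uf _] ex; refine (testP f o false uf _).
  by move: ex => /=; case: (r f) => [[]|] //; case: (o) => [[]|].
- case: l => [|l] // _ ex.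
  have lX : l < size X.
    exact: exec_lt_size ex.
  rewrite lX /=; apply: IH ex _ _ => //; rewrite /run_line /= c0 addnS -addSn.
    exact: control_at_upd c _.
  exact: holds_upd.
(* [Term] raises no flag, so the rest of the program is idle and the registers keep their final
   contents. *)
- move=> _ [<-]; rewrite /run /=; rewrite -/(run _ _) seq_lines_idle //.
  by move=> j; rewrite /= addSnnS; apply: c.
Qed.

Lemma seq_lines_bound (X : seq instr) (p A : nat) :
  size R + p + (size X).+1 <= A ->
  all (fun i : line => i.2 <= A) (seq_lines p X) /\
  size (seq_lines p X) <= 7 * size X.
Proof.
elim: X p => [|u X IH] p //= pA.
have [|a s] := IH p.+1; first lia.
have RA : size R <= A by lia.
have adr f : address f <= A := leq_trans (index_size f R) RA.
rewrite all_cat a andbT size_cat mulnS.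
(* The longest case is a test of a [Set_] instruction: one load, one write and the five lines of the
   test. *)
suff [-> su] : all (fun i : line => i.2 <= A) (instr_lines p (size X) u) /\
    size (instr_lines p (size X) u) <= 7 by split => //; lia.
case: u => [[f [b|]]|[f [b|]]|[f [b|]]|l|] //=; last first.
  by case: ifP => //= lX; split=> //; rewrite /flag; lia.
all: by rewrite ?adr /flag; split=> //; lia.
Qed.

End Straight_line.

(** The accumulator starts as [true], so the first line raises the flag of the first instruction.
    The last line loads [out], which thereby decides acceptance. *)
Definition program (n : nat) (X : seq instr) : seq line :=
  let R := foci n X in
  (MSet true, flag R 0) :: seq_lines R 0 X ++ [:: (MLoad, address R Out)].

Lemma programP (n : nat) (X : seq instr) (w : n.-tuple bool) (b : bool)
    (r : registers) :
  exec 0 X (init_registers w) = Some r -> r Out = Some b ->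
  (run (program n X) (true, nth false w)).1 = b.
Proof.
move=> ex rO; set R := foci n X.
have Rn : n < size R by rewrite size_cat size_map size_iota /=; lia.
set I := [seq Input i.+1 | i <- iota 0 n].
(* Input registers come first in [foci], so they are located exactly where the word has been stored;
   all other registers lie behind it and initially read [false]. *)
have adrI i : i < n -> address R (Input i.+1) = i.
  move=> ni; have Ii : nth Out I i = Input i.+1.
    by rewrite (nth_map 0) ?size_iota // nth_iota.
  rewrite /address /R /foci -/I index_cat -Ii mem_nth ?size_map ?size_iota //.
  rewrite index_uniq ?size_map ?size_iota // map_inj_uniq ?iota_uniq //.
  by move=> j k [].
have adrN f : f \notin I -> nth false w (address R f) = false.
  move=> fI; rewrite nth_default // size_tuple /address /R /foci -/I index_cat.
  by rewrite (negPf fI) size_map size_iota leq_addr.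
rewrite /program -/R -cat1s !run_cat.
set s := run [:: _] _; rewrite /run /= -/(run _ _).
apply: (run_seq_lines (R := R) (r := init_registers w) _ ex) rO.
- by apply/allP => f fX; change (f \in R); rewrite /R /foci mem_cat inE fX !orbT.
- move=> j; rewrite /s /run /= /upd /flag eqn_add2l eq_sym.
  rewrite [RHS](_ : _ = (0 == j)) //; case: eqP => // _.
  by rewrite nth_default // size_tuple; lia.
- move=> f c fR; rewrite /s /run /= /upd ifN; last first.
    by have := address_lt fR; rewrite /flag; lia.
  have noI g : (forall i, g <> Input i) -> g \notin I.
    by move=> gI; apply/negP => /mapP[i _ /gI].
  case: f fR => [[|i]|[|i]|] //= fR.
  + rewrite onthE; case: (ltnP i n) => [ni|ni].
      by rewrite (nth_map false) ?size_tuple // adrI // => -[].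
    by rewrite nth_default // size_map size_tuple.
  + by move=> [<-]; apply/adrN/noI.
  + by move=> [<-]; apply/adrN/noI.
- by rewrite /R /foci mem_cat inE eqxx orbT.
Qed.

Lemma size_foci (n : nat) (X : seq instr) : size (foci n X) <= n + (size X).+1.
Proof.
rewrite size_cat size_map size_iota /= leq_add2l ltnS size_pmap.
exact: count_size.
Qed.

Lemma program_bound (n : nat) (X : seq instr) :
  all (fun i : line => i.2 <= n + 2 * (size X).+1) (program n X) /\
  size (program n X) <= 7 * size X + 2.
Proof.
have sR := size_foci n X.
have [|a s] := @seq_lines_bound (foci n X) X 0 (n + 2 * (size X).+1); first lia.
have adr : address (foci n X) Out <= n + 2 * (size X).+1.
  by apply: leq_trans (leq_trans (index_size _ _) sR) _; lia.
rewrite /= all_cat a /= adr size_cat /flag; split; last by rewrite addn1; lia.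
by rewrite andbT; lia.
Qed.

(** * Containment of NP_IS in NP/poly *)

Lemma NP_IS_sub_NP_poly (f : Defs.family) : NP_IS f -> NP_poly (to_fun f).
Proof.
move=> [h [g [hpoly _ [s [spoly gs]] fg]]].
have /choice[X XP] n := gs (n + h n).
pose advice n := prog_bits (advice_ops n (h n) (program (n + h n) (X n))).
have hb := poly_fun_bounded hpoly.
have [k kb] : poly_bounded (fun n => size (advice n)).
  have mb : poly_bounded (fun n => n + h n).
    exact: poly_bounded_add poly_bounded_id hb.
  have sb : poly_bounded (fun n => s (n + h n)).
    exact: poly_bounded_comp (poly_fun_bounded spoly) mb.
  apply: (@poly_bounded_le _ (fun n => 8 * (h n * 2 +
    (n + h n + 2 * (s (n + h n) + 1) + 1) * (7 * s (n + h n) + 2)))) => [n|].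
    have [_ _ Xs] := XP n.
    have [a sz] := program_bound (n + h n) (X n).
    apply: leq_trans (size_advice_ops _ a) _; first by rewrite leq_addr.
    rewrite leq_mul2l leq_add2l leq_mul //; lia.
  by repeat (apply: poly_bounded_add || apply: poly_bounded_mul) => //;
    exact: poly_bounded_const.
(* The language is the same for all families; only the advice depends on [f]. *)
exists [set x | accepts (init_config interpreter x)], (fun n => n.+2 ^ k), advice.
split=> [|||w]; [exact: interpreter_NP | exact: poly_fun_expn | exact: kb |].
rewrite /to_fun fg /= (accepts_advice _ _ (in_tuple w)).
have progE (c : (h (size w)).-tuple bool) :
    (run (program (size w + h (size w)) (X (size w))) (true, nth false (w ++ c))).1
    = g _ (cat_tuple (in_tuple w) c).
  have [_ Xc _] := XP (size w); have [r [ex rO]] := Xc (cat_tuple (in_tuple w) c).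
  exact: programP ex rO.
by split=> -[c cE]; exists c; move: cE; rewrite progE.
Qed.

Theorem theorem12 : [set to_fun f | f in NP_IS] = NP_poly.
Proof.
apply/seteqP; split=> [F [f fNP <-]|F /NP_poly_sub_NP_IS[f fNP <-]].
  exact: NP_IS_sub_NP_poly.
by exists f.
Qed.
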